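(* Let $(\mathcal X,\mathcal Y)$ be a balanced pair in an abelian category $\mathcal A$. Then, inside the relative bounded derived category $D^b_\ast(\mathcal A)$: (1) If $\mathcal X\text{-}\operatorname{res.dim}\mathcal Y<\infty$, then $K^b(\mathcal Y)\subseteq K^b(\mathcal X)$. (2) If $\mathcal Y\text{-}\operatorname{cores.dim}\mathcal X<\infty$, then $K^b(\mathcal X)\subseteq K^b(\mathcal Y)$.
   Context: $\mathcal A$ is an abelian category; a subcategory of $\mathcal A$ means a full additive subcategory closed under isomorphisms and direct summands. A morphism $f:X\to M$ with $X\in\mathcal X$ is a right $\mathcal X$-approximation of $M$ if every morphism $X'\to M$ with $X'\in\mathcal X$ factors through $f$; $\mathcal X$ is contravariantly finite in $\mathcal A$ if every object of $\mathcal A$ has a right $\mathcal X$-approximation. Left approximations and covariantly finite subcategories are defined dually. A complex $A^\bullet$ in $\mathcal A$ is right $\mathcal X$-acyclic if $\operatorname{Hom}_{\mathcal A}(X,A^\bullet)$ is acyclic for all $X\in\mathcal X$, and left $\mathcal X$-acyclic if $\operatorname{Hom}_{\mathcal A}(A^\bullet,X)$ is acyclic for all $X\in\mathcal X$. For $\mathcal X$ contravariantly finite, an $\mathcal X$-resolution of $M$ is a right $\mathcal X$-acyclic complex $\cdots\to X^{-1}\to X^0\to M\to 0$ with all $X^i\in\mathcal X$; $\mathcal X\text{-}\operatorname{res.dim}M$ is the minimal $n\ge0$ such that there is an $\mathcal X$-resolution $0\to X^{-n}\to\cdots\to X^0\to M\to0$ ($\infty$ if none exists). For $\mathcal Y$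 covariantly finite, a $\mathcal Y$-coresolution of $N$ is a left $\mathcal Y$-acyclic complex $0\to N\to Y^0\to Y^1\to\cdots$ with all $Y^i\in\mathcal Y$; $\mathcal Y\text{-}\operatorname{cores.dim}N$ is defined dually. Put $\mathcal X\text{-}\operatorname{res.dim}\mathcal Y:=\sup\{\mathcal X\text{-}\operatorname{res.dim}Y\mid Y\in\mathcal Y\}$ and $\mathcal Y\text{-}\operatorname{cores.dim}\mathcal X:=\sup\{\mathcal Y\text{-}\operatorname{cores.dim}X\mid X\in\mathcal X\}$. A pair $(\mathcal X,\mathcal Y)$ of subcategories is a balanced pair if $\mathcal X$ is contravariantly finite, $\mathcal Y$ is covariantly finite, every $M\in\mathcal A$ has an $\mathcal X$-resolution that is left $\mathcal Y$-acyclic, and every $N\in\mathcal A$ has a $\mathcal Y$-coresolution that is right $\mathcal X$-acyclic. In that case a complex is right $\mathcal X$-acyclic if and only if it is left $\mathcal Y$-acyclic; such complexes are called $\ast$-acyclic. $D^b_\ast(\mathcal A)$ is the Verdier quotient of the bounded homotopy category $K^b(\mathcal A)$ by the thick subcategory of $\ast$-acyclic complexes. The canonical functors $K^b(\mathcal X)\to D^b_\ast(\mathcal A)$ and $K^b(\mathcal Y)\to D^b_\ast(\mathcal A)$ are fully faithful, and $K^b(\mathcal X)$, $K^b(\mathcal Y)$ are regarded as full triangulated subcategories of $D^b_\ast(\mathcal A)$, up to isomorphism in $D^b_\ast(\mathcal A)$: for instance $K^b(\mathcal Y)\subseteq K^b(\mathcal X)$ means that every bounded complex over $\mathcal Y$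 is isomorphic in $D^b_\ast(\mathcal A)$ to a bounded complex over $\mathcal X$. *)

(* Defs.v *)
From Stdlib Require Import RelationClasses.
From mathcomp Require Import all_boot all_order all_algebra.
From mathcomp Require Import boolp.

Set Implicit Arguments.
Unset Strict Implicit.
Unset Printing Implicit Defensive.

Import GRing.Theory.
Local Open Scope ring_scope.

Definition enat := option nat.
Definition infty : enat := None.

Definition le_enat (m n : enat) : bool :=
  match m, n with
  | _, None => true
  | None, Some _ => false
  | Some m', Some n' => (m' <= n')%N
  end.

Definition least (P : nat -> Prop) : enat :=
  match pselect (exists n, `[< P n >]) with
  | left exP => Some (ex_minn exP)
  | right _ => infty
  end.

Record preadditive := Preadditive {
  obj :> Type;
  hom : obj -> obj -> zmodType;
  idm : forall X, hom X X;
  mcomp : forall X Y Z, hom Y Z -> hom X Y -> hom X Z;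
  mcompA : forall X Y Z T (h : hom Z T) (g : hom Y Z) (f : hom X Y),
    mcomp h (mcomp g f) = mcomp (mcomp h g) f;
  mcomp1m : forall X Y (f : hom X Y), mcomp (idm Y) f = f;
  mcompm1 : forall X Y (f : hom X Y), mcomp f (idm X) = f;
  mcompDl : forall X Y Z (g g' : hom Y Z) (f : hom X Y),
    mcomp (g + g') f = mcomp g f + mcomp g' f;
  mcompDr : forall X Y Z (g : hom Y Z) (f f' : hom X Y),
    mcomp g (f + f') = mcomp g f + mcomp g f'
}.

Arguments hom {p} X Y.
Arguments idm {p} X.
Arguments mcomp {p X Y Z} g f.

Notation "g ∘ f" := (mcomp g f) (at level 40, left associativity) : ring_scope.

Section PreadditiveNotions.
Variable A : preadditive.
Implicit Types X Y Z T : A.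

Definition iso X Y : Prop :=
  exists (f : hom X Y) (g : hom Y X), g ∘ f = idm X /\ f ∘ g = idm Y.

Definition is_zero X : Prop :=
  (forall Y (f : hom X Y), f = 0) /\ (forall Y (f : hom Y X), f = 0).

Definition is_mono X Y (f : hom X Y) : Prop :=
  forall T (g h : hom T X), f ∘ g = f ∘ h -> g = h.

Definition is_epi X Y (f : hom X Y) : Prop :=
  forall T (g h : hom Y T), g ∘ f = h ∘ f -> g = h.

Definition is_kernel K X Y (k : hom K X) (f : hom X Y) : Prop :=
  f ∘ k = 0 /\
  forall T (t : hom T X), f ∘ t = 0 -> exists! u : hom T K, k ∘ u = t.

Definition is_cokernel X Y C (c : hom Y C) (f : hom X Y) : Prop :=
  c ∘ f = 0 /\
  forall T (t : hom Y T), t ∘ f = 0 -> exists! u : hom C T, u ∘ c = t.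

Record biproduct X Y := Biproduct {
  bsum : A;
  in1 : hom X bsum;
  in2 : hom Y bsum;
  pr1 : hom bsum X;
  pr2 : hom bsum Y;
  pr1_in1 : pr1 ∘ in1 = idm X;
  pr2_in2 : pr2 ∘ in2 = idm Y;
  pr1_in2 : pr1 ∘ in2 = 0;
  pr2_in1 : pr2 ∘ in1 = 0;
  in_pr : in1 ∘ pr1 + in2 ∘ pr2 = idm bsum
}.

Lemma mcomp0m X Y Z (f : hom X Y) : (0 : hom Y Z) ∘ f = 0.
Proof. by apply: (addIr (0 ∘ f)); rewrite -mcompDl !add0r. Qed.

Lemma mcompm0 X Y Z (g : hom Y Z) : g ∘ (0 : hom X Y) = 0.
Proof. by apply: (addIr (g ∘ 0)); rewrite -mcompDr !add0r. Qed.

Lemma mcompNm X Y Z (g : hom Y Z) (f : hom X Y) : (- g) ∘ f = - (g ∘ f).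
Proof. by apply: (addIr (g ∘ f)); rewrite -mcompDl !addNr mcomp0m. Qed.

Lemma mcompmN X Y Z (g : hom Y Z) (f : hom X Y) : g ∘ (- f) = - (g ∘ f).
Proof. by apply: (addIr (g ∘ f)); rewrite -mcompDr !addNr mcompm0. Qed.

Lemma mcompBl X Y Z (g g' : hom Y Z) (f : hom X Y) :
  (g - g') ∘ f = g ∘ f - g' ∘ f.
Proof. by rewrite mcompDl mcompNm. Qed.

Lemma mcompBr X Y Z (g : hom Y Z) (f f' : hom X Y) :
  g ∘ (f - f') = g ∘ f - g ∘ f'.
Proof. by rewrite mcompDr mcompmN. Qed.

End PreadditiveNotions.

Arguments bsum {A X Y} b.
Arguments in1 {A X Y} b.
Arguments in2 {A X Y} b.
Arguments pr1 {A X Y} b.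
Arguments pr2 {A X Y} b.

Record abelian_cat := AbelianCat {
  acat :> preadditive;
  zero_object : acat;
  zero_objectP : is_zero zero_object;
  biprod : forall X Y : acat, biproduct X Y;
  kernel_ex : forall (X Y : acat) (f : hom X Y),
    exists (K : acat) (k : hom K X), is_kernel k f;
  cokernel_ex : forall (X Y : acat) (f : hom X Y),
    exists (C : acat) (c : hom Y C), is_cokernel c f;
  mono_normal : forall (X Y : acat) (f : hom X Y), is_mono f ->
    exists (Z : acat) (g : hom Y Z), is_kernel f g;
  epi_normal : forall (X Y : acat) (f : hom X Y), is_epi f ->
    exists (Z : acat) (g : hom Z X), is_cokernel f g
}.

Arguments biprod {a} X Y.

(* Cohomological grading by int.  Conditions relating a degree to its
   predecessor are written at degree n + 1, for all n : int, so that no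
   transport along n - 1 + 1 = n is needed. *)
Record complex (A : preadditive) := Complex {
  cobj :> int -> A;
  diff : forall n : int, hom (cobj n) (cobj (n + 1));
  diffK : forall n : int, diff (n + 1) ∘ diff n = 0
}.

Arguments diff {A} c n.

Definition is_bounded (A : preadditive) (C : complex A) : Prop :=
  exists a b : int, forall n : int, n < a \/ b < n -> is_zero (C n).

Record bcomplex (A : preadditive) := BComplex {
  bcplx :> complex A;
  bcplxP : is_bounded bcplx
}.

Record chain_map (A : preadditive) (C D : complex A) := ChainMap {
  cmap :> forall n : int, hom (C n) (D n);
  cmapP : forall n : int, diff D n ∘ cmap n = cmap (n + 1) ∘ diff C n
}.

Section ChainMaps.
Variable A : preadditive.
Implicit Types C D E : complex A.

Definition homotopic C D (f g : chain_map C D) : Prop :=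
  exists s : forall n : int, hom (C (n + 1)) (D n),
    forall n : int,
      f (n + 1) - g (n + 1) = diff D n ∘ s n + s (n + 1) ∘ diff C (n + 1).

Lemma id_chain_subproof C (n : int) :
  diff C n ∘ idm (C n) = idm (C (n + 1)) ∘ diff C n.
Proof. by rewrite mcomp1m mcompm1. Qed.

Definition id_chain C : chain_map C C := ChainMap (@id_chain_subproof C).

Lemma comp_chain_subproof C D E (g : chain_map D E) (f : chain_map C D)
    (n : int) :
  diff E n ∘ (g n ∘ f n) = (g (n + 1) ∘ f (n + 1)) ∘ diff C n.
Proof. by rewrite mcompA cmapP -mcompA cmapP mcompA. Qed.

Definition comp_chain C D E (g : chain_map D E) (f : chain_map C D) :
  chain_map C E := ChainMap (comp_chain_subproof g f).

Lemma homotopic_refl C D (f : chain_map C D) : homotopic f f.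
Proof.
by exists (fun=> 0) => n; rewrite subrr mcompm0 mcomp0m addr0.
Qed.

Lemma homotopic_sym C D (f g : chain_map C D) :
  homotopic f g -> homotopic g f.
Proof.
move=> [s sP]; exists (fun n => - s n) => n.
by rewrite -opprB sP opprD mcompmN mcompNm.
Qed.

Lemma homotopic_trans C D (f g h : chain_map C D) :
  homotopic f g -> homotopic g h -> homotopic f h.
Proof.
move=> [s sP] [t tP]; exists (fun n => s n + t n) => n.
by rewrite mcompDr mcompDl addrACA -sP -tP addrA subrK.
Qed.

Lemma homotopic_equiv C D : Equivalence (@homotopic C D).
Proof.
split; [exact: homotopic_refl | exact: homotopic_sym | exact: homotopic_trans].
Qed.

Lemma homotopic_comp C D E (g g' : chain_map D E) (f f' : chain_map C D) :
  homotopic g g' -> homotopic f f' ->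
  homotopic (comp_chain g f) (comp_chain g' f').
Proof.
move=> [t tP] [s sP].
exists (fun n => g n ∘ s n + t n ∘ f' (n + 1)) => n /=.
have -> : g (n + 1) ∘ f (n + 1) - g' (n + 1) ∘ f' (n + 1) =
    g (n + 1) ∘ (f (n + 1) - f' (n + 1)) +
    (g (n + 1) - g' (n + 1)) ∘ f' (n + 1).
  by rewrite mcompBr mcompBl addrA subrK.
rewrite sP tP !mcompDr !mcompDl addrACA !mcompA cmapP; congr (_ + (_ + _)).
by rewrite -!mcompA cmapP.
Qed.

End ChainMaps.

Record category := Category {
  cat_obj :> Type;
  cat_hom : cat_obj -> cat_obj -> Type;
  cat_eq : forall X Y, cat_hom X Y -> cat_hom X Y -> Prop;
  cat_id : forall X, cat_hom X X;
  cat_comp : forall X Y Z, cat_hom Y Z -> cat_hom X Y -> cat_hom X Z;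
  cat_eq_equiv : forall X Y, Equivalence (@cat_eq X Y);
  cat_eq_comp : forall X Y Z (g g' : cat_hom Y Z) (f f' : cat_hom X Y),
    cat_eq g g' -> cat_eq f f' -> cat_eq (cat_comp g f) (cat_comp g' f');
  cat_compA : forall X Y Z T (h : cat_hom Z T) (g : cat_hom Y Z)
      (f : cat_hom X Y),
    cat_eq (cat_comp h (cat_comp g f)) (cat_comp (cat_comp h g) f);
  cat_comp1m : forall X Y (f : cat_hom X Y), cat_eq (cat_comp (cat_id Y) f) f;
  cat_compm1 : forall X Y (f : cat_hom X Y), cat_eq (cat_comp f (cat_id X)) f
}.

Arguments cat_hom {c} X Y.
Arguments cat_eq {c X Y} f g.
Arguments cat_id {c} X.
Arguments cat_comp {c X Y Z} g f.

Definition isomorphic (K : category) (X Y : K) : Prop :=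
  exists (f : cat_hom X Y) (g : cat_hom Y X),
    cat_eq (cat_comp g f) (cat_id X) /\ cat_eq (cat_comp f g) (cat_id Y).

(* The localization K[W^-1] of Gabriel and Zisman: morphisms are formal
   composites of morphisms of K and of formal inverses of morphisms in W,
   modulo the congruence generated by functoriality of K -> K[W^-1] and
   invertibility of W. *)
Section Localization.
Variables (K : category) (W : forall X Y : K, cat_hom X Y -> Prop).

Inductive loc_hom : K -> K -> Type :=
| loc_of X Y (f : cat_hom X Y) : loc_hom X Y
| loc_inv X Y (s : cat_hom X Y) (sW : W s) : loc_hom Y X
| loc_comp X Y Z (g : loc_hom Y Z) (f : loc_hom X Y) : loc_hom X Z.

Inductive loc_eq : forall X Y, loc_hom X Y -> loc_hom X Y -> Prop :=
| loc_eq_refl X Y (f : loc_hom X Y) : loc_eq f f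
| loc_eq_sym X Y (f g : loc_hom X Y) : loc_eq f g -> loc_eq g f
| loc_eq_trans X Y (f g h : loc_hom X Y) :
    loc_eq f g -> loc_eq g h -> loc_eq f h
| loc_eq_comp X Y Z (g g' : loc_hom Y Z) (f f' : loc_hom X Y) :
    loc_eq g g' -> loc_eq f f' -> loc_eq (loc_comp g f) (loc_comp g' f')
| loc_compA X Y Z T (h : loc_hom Z T) (g : loc_hom Y Z) (f : loc_hom X Y) :
    loc_eq (loc_comp h (loc_comp g f)) (loc_comp (loc_comp h g) f)
| loc_comp1m X Y (f : loc_hom X Y) :
    loc_eq (loc_comp (loc_of (cat_id Y)) f) f
| loc_compm1 X Y (f : loc_hom X Y) :
    loc_eq (loc_comp f (loc_of (cat_id X))) f
| loc_of_eq X Y (f g : cat_hom X Y) :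
    cat_eq f g -> loc_eq (loc_of f) (loc_of g)
| loc_of_comp X Y Z (g : cat_hom Y Z) (f : cat_hom X Y) :
    loc_eq (loc_of (cat_comp g f)) (loc_comp (loc_of g) (loc_of f))
| loc_invK X Y (s : cat_hom X Y) (sW : W s) :
    loc_eq (loc_comp (loc_inv sW) (loc_of s)) (loc_of (cat_id X))
| loc_Kinv X Y (s : cat_hom X Y) (sW : W s) :
    loc_eq (loc_comp (loc_of s) (loc_inv sW)) (loc_of (cat_id Y)).

Lemma loc_eq_equiv X Y : Equivalence (@loc_eq X Y).
Proof.
split; [exact: loc_eq_refl | exact: loc_eq_sym | exact: loc_eq_trans].
Qed.

Definition localization : category :=
  Category loc_eq_equiv loc_eq_comp loc_compA loc_comp1m loc_compm1.

End Localization.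

Section HomotopyCategory.
Variable A : preadditive.

Lemma eq_homotopic (C D : complex A) (f g : chain_map C D) :
  (forall n, f n = g n) -> homotopic f g.
Proof.
move=> fg; exists (fun=> 0) => n.
by rewrite fg subrr mcompm0 mcomp0m addr0.
Qed.

Definition Kb : category.
refine (@Category (bcomplex A) (fun C D => chain_map C D)
  (fun C D => @homotopic A C D) (fun C => id_chain C)
  (fun C D E => @comp_chain A C D E)
  (fun C D => homotopic_equiv C D)
  (fun C D E => @homotopic_comp A C D E) _ _ _).
- by move=> *; apply: eq_homotopic => n /=; rewrite mcompA.
- by move=> *; apply: eq_homotopic => n /=; rewrite mcomp1m.
- by move=> *; apply: eq_homotopic => n /=; rewrite mcompm1.
Defined.

End HomotopyCategory.

Section Cone.
Variables (A : abelian_cat) (C D : complex A) (f : chain_map C D).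

Definition cone_obj (n : int) : A := bsum (biprod (C (n + 1)) (D n)).

(* The matrix (- d_C, 0; f, d_D). *)
Definition cone_diff (n : int) : hom (cone_obj n) (cone_obj (n + 1)) :=
  in1 (biprod _ _) ∘ (- diff C (n + 1)) ∘ pr1 (biprod _ _) +
  in2 (biprod _ _) ∘ f (n + 1) ∘ pr1 (biprod _ _) +
  in2 (biprod _ _) ∘ diff D n ∘ pr2 (biprod _ _).

Lemma cone_diffK (n : int) : cone_diff (n + 1) ∘ cone_diff n = 0.
Proof.
rewrite /cone_diff.
set i1 := in1 _; set i2 := in2 _; set j1 := in1 _; set j2 := in2 _.
set p1 := pr1 _; set p2 := pr2 _; set q1 := pr1 _; set q2 := pr2 _.
have e11 : p1 ∘ j1 = idm _ by apply: pr1_in1.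
have e12 : p1 ∘ j2 = 0 by apply: pr1_in2.
have e21 : p2 ∘ j1 = 0 by apply: pr2_in1.
have e22 : p2 ∘ j2 = idm _ by apply: pr2_in2.
pose simp := (e11, e12, e21, e22).
have Ep1 T (a : hom T _) (b : hom T _) (c : hom T _) :
    p1 ∘ (j1 ∘ a + j2 ∘ b + j2 ∘ c) = a.
  by rewrite !mcompDr !mcompA !simp !mcomp0m mcomp1m !addr0.
have Ep2 T (a : hom T _) (b : hom T _) (c : hom T _) :
    p2 ∘ (j1 ∘ a + j2 ∘ b + j2 ∘ c) = b + c.
  by rewrite !mcompDr !mcompA !simp !mcomp0m !mcomp1m add0r.
rewrite -!mcompA !mcompDl -!mcompA Ep1 Ep2.
rewrite !mcompDr !mcompNm !mcompmN !opprK !mcompA.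
rewrite -(mcompA i1) diffK mcompm0 mcomp0m add0r.
rewrite -(mcompA i2 (diff D _) (f _)) cmapP mcompA addrA addNr add0r.
by rewrite -(mcompA i2) diffK mcompm0 mcomp0m.
Qed.

Definition cone : complex A := Complex cone_diffK.

End Cone.

Section Relative.
Variable A : abelian_cat.
Implicit Types (X Y U V : A -> Prop) (C : complex A) (M N : A).

(* Full subcategories are given by their class of objects. *)
Definition is_subcategory X : Prop :=
  [/\ forall M N, iso M N -> X M -> X N,
      forall M, is_zero M -> X M,
      forall M N (S : biproduct M N), X M -> X N -> X (bsum S) &
      forall M N (S : biproduct M N), X (bsum S) -> X M /\ X N].

Definition right_approximation X M (P : A) (f : hom P M) : Prop :=
  X P /\ forall P' (g : hom P' M), X P' -> exists h : hom P' P, f ∘ h = g.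

Definition left_approximation Y N (Q : A) (f : hom N Q) : Prop :=
  Y Q /\ forall Q' (g : hom N Q'), Y Q' -> exists h : hom Q Q', h ∘ f = g.

Definition contravariantly_finite X : Prop :=
  forall M, exists (P : A) (f : hom P M), right_approximation X f.

Definition covariantly_finite Y : Prop :=
  forall N, exists (Q : A) (f : hom N Q), left_approximation Y f.

(* Acyclicity of Hom(P, C) for all P in X. *)
Definition right_acyclic X C : Prop :=
  forall P, X P -> forall (n : int) (f : hom P (C (n + 1))),
    diff C (n + 1) ∘ f = 0 -> exists g : hom P (C n), diff C n ∘ g = f.

(* Acyclicity of Hom(C, Q) for all Q in Y. *)
Definition left_acyclic Y C : Prop :=
  forall Q, Y Q -> forall (n : int) (f : hom (C (n + 1)) Q),
    f ∘ diff C n = 0 ->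
    exists g : hom (C (n + 1 + 1)) Q, g ∘ diff C (n + 1) = f.

(* The augmented complex ... -> X^-1 -> X^0 -> M -> 0, with M in degree 1. *)
Definition resolution X M C : Prop :=
  [/\ iso (C 1) M, forall n : int, n <= 0 -> X (C n),
      forall n : int, 1 < n -> is_zero (C n) & right_acyclic X C].

(* The augmented complex 0 -> N -> Y^0 -> Y^1 -> ..., with N in degree -1. *)
Definition coresolution Y N C : Prop :=
  [/\ iso (C (- 1)) N, forall n : int, 0 <= n -> Y (C n),
      forall n : int, n < - 1 -> is_zero (C n) & left_acyclic Y C].

Definition res_dim X M : enat :=
  least (fun n : nat => exists C, resolution X M C /\
    forall i : int, i < - n%:Z -> is_zero (C i)).

Definition cores_dim Y N : enat :=
  least (fun n : nat => exists C, coresolution Y N C /\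
    forall i : int, n%:Z < i -> is_zero (C i)).

(* Suprema over a class of objects, as least upper bounds in enat. *)
Definition res_dim_sup X Y : enat :=
  least (fun n => forall M, Y M -> le_enat (res_dim X M) (Some n)).

Definition cores_dim_sup Y X : enat :=
  least (fun n => forall N, X N -> le_enat (cores_dim Y N) (Some n)).

Definition balanced_pair X Y : Prop :=
  [/\ is_subcategory X /\ is_subcategory Y,
      contravariantly_finite X, covariantly_finite Y,
      forall M, exists C, resolution X M C /\ left_acyclic Y C &
      forall N, exists C, coresolution Y N C /\ right_acyclic X C].

(* For a balanced pair the two conditions are equivalent. *)
Definition star_acyclic X Y C : Prop := right_acyclic X C /\ left_acyclic Y C.

(* The Verdier quotient of Kb A by the star-acyclic complexes: the
   localization at the morphisms whose cone is star-acyclic. *)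
Definition Db X Y : category :=
  @localization (Kb A)
    (fun (C D : Kb A) (f : cat_hom C D) => star_acyclic X Y (cone f)).

Definition over U (C : bcomplex A) : Prop := forall n : int, U (C n).

(* Kb(U) is contained in Kb(V), up to isomorphism in Db X Y. *)
Definition Kb_included X Y U V : Prop :=
  forall C : bcomplex A, over U C ->
    exists D : bcomplex A, over V D /\ @isomorphic (Db X Y) C D.

End Relative.

(* Main.v *)
From mathcomp Require Import all_boot all_order all_algebra.
From mathcomp Require Import boolp zify.
Require Import Defs.

(** The first inclusion holds for every bounded complex C whose terms have
    X-resolutions of length at most m, by induction on m.  Choose in each degree
    a right X-approximation p : P^n -> C^n with kernel k : K^n -> P^n, where K^n
    has an X-resolution of length at most m - 1.  The differential of C lifts to
    maps h : P^n -> P^{n+1}; these restrict to maps ka : K^n -> K^{n+1}, and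
    since p h h = 0 the composite h h is k th for some th : P^n -> K^{n+2}.  The
    objects P^n + K^{n+1} with differential (h, k; - th, - ka) form a bounded
    complex D, and (p, 0) : D -> C is a chain map.  Its cone is star-acyclic as
    soon as every sequence K^n -> P^n -> C^n becomes short exact under
    Hom(P', -) for P' in X and under Hom(-, Q) for Q in Y
    ([lower_resolution]).  Hence C is isomorphic to D in the relative derived
    category, and the terms of D have X-resolutions of length at most m - 1.

    Exactness under Hom(P', -) is the approximation property.  Exactness under
    Hom(-, Q) comes from the balanced pair, by comparing the sequence with an
    X-resolution of C^n that is left Y-acyclic ([approx_seq_left_exact]).

    The second inclusion is dual.  The statements about single objects and
    sequences are applied to the opposite category; only the steps that depend
    on the grading are carried out again.  In the construction of D
    ([lower_coresolution]) one now has left approximations C^n -> Q^n, their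
    cokernels L^{n+1}, and D^n = Q^n + L^n. *)

Set Implicit Arguments.
Unset Strict Implicit.
Unset Printing Implicit Defensive.

Import Order.TTheory GRing.Theory Num.Theory.
Local Open Scope ring_scope.

(** * Kernels, cokernels and matrices *)

Section Preadditive.
Variable A : preadditive.
Implicit Types X Y Z T : A.

Lemma kernel_lift K X Y (k : hom K X) (f : hom X Y) T (t : hom T X) :
  is_kernel k f -> f ∘ t = 0 -> exists u : hom T K, k ∘ u = t.
Proof. by move=> [_ kP] /kP[u [uP _]]; exists u. Qed.

Lemma kernel_mono K X Y (k : hom K X) (f : hom X Y) :
  is_kernel k f -> is_mono k.
Proof.
move=> [fk kP] T u v kuv.
have /kP[w [_ wU]] : f ∘ (k ∘ v) = 0 by rewrite mcompA fk mcomp0m.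
by rewrite -(wU u kuv) -(wU v erefl).
Qed.

Lemma cokernel_desc X Y L (c : hom Y L) (f : hom X Y) T (t : hom Y T) :
  is_cokernel c f -> t ∘ f = 0 -> exists u : hom L T, u ∘ c = t.
Proof. by move=> [_ cP] /cP[u [uP _]]; exists u. Qed.

Lemma cokernel_epi X Y L (c : hom Y L) (f : hom X Y) :
  is_cokernel c f -> is_epi c.
Proof.
move=> [cf cP] T u v cuv.
have /cP[w [_ wU]] : v ∘ c ∘ f = 0 by rewrite -mcompA cf mcompm0.
by rewrite -(wU u cuv) -(wU v erefl).
Qed.

Lemma is_zeroP X : idm X = 0 -> is_zero X.
Proof.
move=> X0; split=> Y f; first by rewrite -[f]mcompm1 X0 mcompm0.
by rewrite -[f]mcomp1m X0 mcomp0m.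
Qed.

Lemma kernel_zero K X Y (k : hom K X) (f : hom X Y) :
  is_kernel k f -> is_zero X -> is_zero K.
Proof.
move=> kf [_ X0]; apply: is_zeroP; apply: (kernel_mono kf).
by rewrite (X0 _ (k ∘ _)) mcompm0.
Qed.

Lemma cokernel_zero X Y L (c : hom Y L) (f : hom X Y) :
  is_cokernel c f -> is_zero Y -> is_zero L.
Proof.
move=> cf [Y0 _]; apply: is_zeroP; apply: (cokernel_epi cf).
by rewrite (Y0 _ (_ ∘ c)) mcomp0m.
Qed.

(** The morphism T -> X + Y with components u and v. *)
Definition pair_hom X Y (S : biproduct X Y) T (u : hom T X) (v : hom T Y) :
  hom T (bsum S) := in1 S ∘ u + in2 S ∘ v.

(** The morphism X + Y -> T with restrictions u and v. *)
Definition copair_hom X Y (S : biproduct X Y) T (u : hom X T) (v : hom Y T) :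
  hom (bsum S) T := u ∘ pr1 S + v ∘ pr2 S.

(** The morphism X + Y -> X' + Y' with matrix (a, b; c, e). *)
Definition mat_hom X Y X' Y' (S : biproduct X Y) (S' : biproduct X' Y')
    (a : hom X X') (b : hom Y X') (c : hom X Y') (e : hom Y Y') :
  hom (bsum S) (bsum S') :=
  pair_hom S' (copair_hom S a b) (copair_hom S c e).

Section Biproduct.
Variables (X Y : A) (S : biproduct X Y).

Lemma pr1_pair T (u : hom T X) (v : hom T Y) : pr1 S ∘ pair_hom S u v = u.
Proof.
by rewrite mcompDr !mcompA pr1_in1 pr1_in2 mcomp0m mcomp1m addr0.
Qed.

Lemma pr2_pair T (u : hom T X) (v : hom T Y) : pr2 S ∘ pair_hom S u v = v.
Proof.
by rewrite mcompDr !mcompA pr2_in1 pr2_in2 mcomp0m mcomp1m add0r.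
Qed.

Lemma pair_pr T (f : hom T (bsum S)) : f = pair_hom S (pr1 S ∘ f) (pr2 S ∘ f).
Proof. by rewrite /pair_hom !mcompA -mcompDl in_pr mcomp1m. Qed.

Lemma copair_in T (f : hom (bsum S) T) :
  f = copair_hom S (f ∘ in1 S) (f ∘ in2 S).
Proof. by rewrite /copair_hom -!mcompA -mcompDr in_pr mcompm1. Qed.

Lemma copair_pair T T' (f : hom X T) (g : hom Y T) (u : hom T' X)
    (v : hom T' Y) :
  copair_hom S f g ∘ pair_hom S u v = f ∘ u + g ∘ v.
Proof. by rewrite mcompDl -!mcompA pr1_pair pr2_pair. Qed.

Lemma pair_inj T (u u' : hom T X) (v v' : hom T Y) :
  pair_hom S u v = pair_hom S u' v' -> u = u' /\ v = v'.
Proof.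
move=> e; split; first by rewrite -(pr1_pair u v) e pr1_pair.
by rewrite -(pr2_pair u v) e pr2_pair.
Qed.

Lemma pair00 T : pair_hom S 0 0 = 0 :> hom T _.
Proof. by rewrite /pair_hom !mcompm0 addr0. Qed.

Lemma copair00 T : copair_hom S 0 0 = 0 :> hom _ T.
Proof. by rewrite /copair_hom !mcomp0m addr0. Qed.

Lemma copair_in1 T (f : hom X T) (g : hom Y T) : copair_hom S f g ∘ in1 S = f.
Proof.
by rewrite mcompDl -!mcompA pr1_in1 pr2_in1 mcompm0 mcompm1 addr0.
Qed.

Lemma copair_in2 T (f : hom X T) (g : hom Y T) : copair_hom S f g ∘ in2 S = g.
Proof.
by rewrite mcompDl -!mcompA pr1_in2 pr2_in2 mcompm0 mcompm1 add0r.
Qed.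

Lemma copair_inj T (f f' : hom X T) (g g' : hom Y T) :
  copair_hom S f g = copair_hom S f' g' -> f = f' /\ g = g'.
Proof.
move=> e; split; first by rewrite -(copair_in1 f g) e copair_in1.
by rewrite -(copair_in2 f g) e copair_in2.
Qed.

Lemma comp_pair T T' (u : hom T X) (v : hom T Y) (w : hom T' T) :
  pair_hom S u v ∘ w = pair_hom S (u ∘ w) (v ∘ w).
Proof. by rewrite mcompDl -!mcompA. Qed.

Lemma comp_copair T T' (f : hom X T) (g : hom Y T) (w : hom T T') :
  w ∘ copair_hom S f g = copair_hom S (w ∘ f) (w ∘ g).
Proof. by rewrite mcompDr !mcompA. Qed.

Lemma pairD T (u u' : hom T X) (v v' : hom T Y) :
  pair_hom S u v + pair_hom S u' v' = pair_hom S (u + u') (v + v').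
Proof. by rewrite /pair_hom !mcompDr addrACA. Qed.

Lemma copairD T (f f' : hom X T) (g g' : hom Y T) :
  copair_hom S f g + copair_hom S f' g' = copair_hom S (f + f') (g + g').
Proof. by rewrite /copair_hom !mcompDl addrACA. Qed.

Lemma biproduct_zero : is_zero X -> is_zero Y -> is_zero (bsum S).
Proof.
move=> [X0 _] [Y0 _]; apply: is_zeroP.
by rewrite [idm _]copair_in (X0 _ (_ ∘ _)) (Y0 _ (_ ∘ _)) copair00.
Qed.

End Biproduct.

Section Matrix.
Variables (X Y X' Y' : A) (S : biproduct X Y) (S' : biproduct X' Y').
Variables (a : hom X X') (b : hom Y X') (c : hom X Y') (e : hom Y Y').

Lemma mat_pair T (u : hom T X) (v : hom T Y) :
  mat_hom S S' a b c e ∘ pair_hom S u v =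
  pair_hom S' (a ∘ u + b ∘ v) (c ∘ u + e ∘ v).
Proof. by rewrite comp_pair !copair_pair. Qed.

Lemma copair_mat T (f : hom X' T) (g : hom Y' T) :
  copair_hom S' f g ∘ mat_hom S S' a b c e =
  copair_hom S (f ∘ a + g ∘ c) (f ∘ b + g ∘ e).
Proof. by rewrite copair_pair !comp_copair copairD. Qed.

End Matrix.

End Preadditive.

(** * The opposite category *)

(** The opposite category has the same objects and groups of morphisms, so that
    notions dual to each other in A and in its opposite are convertible. *)
Definition opp_preadditive (A : preadditive) : preadditive.
Proof.
refine (@Preadditive (obj A) (fun X Y => hom Y X) (fun X => idm X)
  (fun X Y Z g f => f ∘ g) _ _ _ _ _).
- by move=> *; rewrite mcompA.
- by move=> *; rewrite mcompm1.
- by move=> *; rewrite mcomp1m.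
- by move=> *; rewrite mcompDr.
- by move=> *; rewrite mcompDl.
Defined.

Definition opp_biproduct (A : preadditive) (X Y : A) (S : biproduct X Y) :
  @biproduct (opp_preadditive A) X Y :=
  @Biproduct (opp_preadditive A) X Y (bsum S) (pr1 S) (pr2 S) (in1 S) (in2 S)
    (pr1_in1 S) (pr2_in2 S) (pr2_in1 S) (pr1_in2 S) (in_pr S).

Lemma is_zero_opp (A : preadditive) (X : A) :
  is_zero X -> @is_zero (opp_preadditive A) X.
Proof. by case. Qed.

Definition opp_abelian (A : abelian_cat) : abelian_cat :=
  @AbelianCat (opp_preadditive A) (zero_object A)
    (is_zero_opp (zero_objectP A)) (fun X Y => opp_biproduct (biprod X Y))
    (fun X Y f => cokernel_ex f) (fun X Y f => kernel_ex f)
    (fun X Y f => @epi_normal A Y X f) (fun X Y f => @mono_normal A Y X f).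

(** * Approximation sequences *)

Section Sequences.
Variable A : abelian_cat.
Implicit Types (X Y : A -> Prop) (M N K P Q L : A).

(** A sequence 0 -> K -> P -> M in which P -> M is a right X-approximation
    with kernel K. *)
Definition approx_seq X K P M (k : hom K P) (p : hom P M) : Prop :=
  right_approximation X p /\ is_kernel k p.

(** A sequence N -> Q -> L -> 0 in which N -> Q is a left Y-approximation with
    cokernel L. *)
Definition coapprox_seq Y N Q L (j : hom N Q) (c : hom Q L) : Prop :=
  left_approximation Y j /\ is_cokernel c j.

(** The functors Hom(-, Q), for Q in Y, turn K -> P -> M into a short exact
    sequence. *)
Definition left_exact_seq Y K P M (k : hom K P) (p : hom P M) : Prop :=
  forall Q, Y Q ->
  [/\ forall f : hom M Q, f ∘ p = 0 -> f = 0,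
      forall g : hom P Q, g ∘ k = 0 -> exists m : hom M Q, m ∘ p = g &
      forall f : hom K Q, exists g : hom P Q, g ∘ k = f].

(** The functors Hom(P, -), for P in X, turn N -> Q -> L into a short exact
    sequence. *)
Definition right_exact_seq X N Q L (j : hom N Q) (c : hom Q L) : Prop :=
  forall P, X P ->
  [/\ forall f : hom P N, j ∘ f = 0 -> f = 0,
      forall g : hom P Q, c ∘ g = 0 -> exists m : hom P N, j ∘ m = g &
      forall f : hom P L, exists g : hom P Q, c ∘ g = f].

(** The last terms S2 -> S1 -> S0 -> M -> 0 of an X-resolution of M that is
    left Y-acyclic, with the part of its exactness that involves them only. *)
Definition balanced_presentation X Y M : Prop :=
  exists (S0 S1 S2 : A) (q : hom S0 M) (d1 : hom S1 S0) (d2 : hom S2 S1),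
  [/\ q ∘ d1 = 0, d1 ∘ d2 = 0, right_approximation X q,
      forall P (f : hom P S0), X P -> q ∘ f = 0 ->
        exists r : hom P S1, d1 ∘ r = f &
      forall Q, Y Q ->
      [/\ forall f : hom M Q, f ∘ q = 0 -> f = 0,
          forall g : hom S0 Q, g ∘ d1 = 0 -> exists m : hom M Q, m ∘ q = g &
          forall f : hom S1 Q, f ∘ d2 = 0 ->
            exists g : hom S0 Q, g ∘ d1 = f]].

(** The approximation q in the presentation factors through p, so that the
    injectivity of Hom(q, Q) carries over to Hom(p, Q). *)
Lemma approximation_left_inj X Y P M (p : hom P M) Q (f : hom M Q) :
  balanced_presentation X Y M -> right_approximation X p -> Y Q ->
  f ∘ p = 0 -> f = 0.
Proof.
move=> [S0 [S1 [S2 [q [d1 [d2 [_ _ [XS0 _] _ qY]]]]]]] [_ pX] YQ fp.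
have [q1 _ _] := qY Q YQ; apply: q1.
by have [u <-] := pX _ q XS0; rewrite mcompA fp mcomp0m.
Qed.

(** Comparing the sequence with a presentation of M by maps u and v over M, one
    gets u v - 1 = k t; this transfers exactness of Hom(-, Q) from the
    presentation to the sequence. *)
Lemma approx_seq_left_exact X Y K P M (k : hom K P) (p : hom P M) :
  (forall N, balanced_presentation X Y N) ->
  approx_seq X k p -> left_exact_seq Y k p.
Proof.
move=> bal [pA kP] Q YQ; have [XP pX] := pA.
split=> [f|g gk|f]; first exact: approximation_left_inj (bal M) pA YQ.
all: have [S0 [S1 [S2 [q [d1 [d2 [qd1 d12 [XS0 qX] q0 qY]]]]]]] := bal M.
all: have [_ qY0 qY1] := qY Q YQ.
all: have [u pu] := pX _ q XS0; have [v qv] := qX _ p XP.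
all: have [t kt] : exists t, k ∘ t = u ∘ v - idm P
  by apply: kernel_lift kP _; rewrite mcompBr mcompA pu qv mcompm1 subrr.
all: have [e ke] : exists e, k ∘ e = u ∘ d1
  by apply: kernel_lift kP _; rewrite mcompA pu qd1.
- have [|m mq] := qY0 (g ∘ u); first by rewrite -mcompA -ke mcompA gk mcomp0m.
  exists m; rewrite -qv mcompA mq -mcompA.
  apply/eqP; rewrite -subr_eq0 -{2}[g]mcompm1 -mcompBr -kt mcompA gk.
  by rewrite mcomp0m.
have kmono := kernel_mono kP.
have ed2 : e ∘ d2 = 0.
  by apply: kmono; rewrite mcompA ke -mcompA d12 !mcompm0.
have [|g gd1] := qY1 (f ∘ e); first by rewrite -mcompA ed2 mcompm0.
exists (g ∘ v - f ∘ t).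
(* It is enough to compare both sides on an object of X approximating K. *)
have [T0 [T1 [T2 [s [_ [_ [_ _ sA _ _]]]]]]] := bal K.
apply/eqP; rewrite -subr_eq0; apply/eqP.
apply: (approximation_left_inj (bal K) sA YQ); have [XT _] := sA.
have [|r rP] := q0 _ (v ∘ k ∘ s) XT.
  by rewrite !mcompA qv (proj1 kP) mcomp0m.
have tks : t ∘ k ∘ s = e ∘ r - s.
  apply: kmono; rewrite mcompBr !mcompA kt ke -(mcompA u d1) rP.
  by rewrite !mcompBl mcomp1m !mcompA.
have -> : ((g ∘ v - f ∘ t) ∘ k - f) ∘ s =
    g ∘ (v ∘ k ∘ s) - f ∘ (t ∘ k ∘ s) - f ∘ s by rewrite !mcompBl !mcompA.
by rewrite -rP tks mcompBr !mcompA gd1 subKr subrr.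
Qed.

(** M has an X-resolution of length at most m, built from successive
    approximation sequences. *)
Fixpoint res_length X (m : nat) M : Prop :=
  if m is m'.+1 then
    exists (P K : A) (k : hom K P) (p : hom P M),
      approx_seq X k p /\ res_length X m' K
  else X M.

Lemma approx_seq_zero X M :
  (forall N, is_zero N -> X N) -> is_zero M ->
  approx_seq X (idm M) (idm M).
Proof.
move=> X0 M0; split; first by split=> [|P' g _]; [exact: X0|exists g; rewrite mcomp1m].
split=> [|T t _]; first exact: (proj1 M0).
by exists t; split=> [|u <-]; rewrite mcomp1m.
Qed.

Lemma res_length_zero X m M :
  (forall N, is_zero N -> X N) -> is_zero M -> res_length X m M.
Proof.
move=> X0 M0; elim: m => [|m IHm] /=; first exact: X0.
by exists M, M, (idm M), (idm M); split=> //; apply: approx_seq_zero.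
Qed.

(** The sequence can be chosen to vanish over a zero object, so that bounded
    complexes have bounded approximations. *)
Lemma res_length_seq X m M :
  (forall N, is_zero N -> X N) -> res_length X m.+1 M ->
  exists (P K : A) (k : hom K P) (p : hom P M),
    [/\ approx_seq X k p, res_length X m K &
        is_zero M -> is_zero P /\ is_zero K].
Proof.
move=> X0 MX; have [M0|M0] := pselect (is_zero M).
  exists M, M, (idm M), (idm M); split=> //; first exact: approx_seq_zero.
  exact: res_length_zero.
by have [P [K [k [p [kp KX]]]]] := MX; exists P, K, k, p; split.
Qed.

Lemma res_length_biprod X m P K :
  (forall M N, X M -> X N -> X (bsum (biprod M N))) ->
  X P -> res_length X m K -> res_length X m (bsum (biprod P K)).
Proof.
move=> XD XP; elim: m K => [|m IHm] K /=; first exact: XD.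
move=> [Q [K' [k [q [[[XQ qX] kq] K'X]]]]].
exists (bsum (biprod P Q)), K', (pair_hom (biprod P Q) 0 k).
exists (mat_hom (biprod P Q) (biprod P K) (idm P) 0 0 q); split=> //.
split; first split=> [|P' g XP']; first exact: XD.
  have [h hP] := qX P' (pr2 (biprod P K) ∘ g) XP'.
  exists (pair_hom (biprod P Q) (pr1 (biprod P K) ∘ g) h).
  rewrite [RHS]pair_pr mat_pair hP !mcomp0m mcomp1m add0r addr0 //.
split=> [|T t].
  by rewrite mat_pair (proj1 kq) !mcomp0m mcompm0 !addr0 pair00.
rewrite {1}[t]pair_pr mat_pair -(pair00 (biprod P K) T) => /pair_inj[].
rewrite !mcomp0m mcomp1m addr0 add0r => t1 /(kernel_lift kq)[u ku].
exists u; split=> [|u']; first by rewrite comp_pair mcomp0m ku -t1 -pair_pr.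
move=> e; apply: (kernel_mono kq); rewrite ku -e comp_pair pr2_pair //.
Qed.

(** If C' -> C -> E is exact under Hom(P, -) for P in X, and C' is in X, then C'
    maps onto the kernel of C -> E by a right X-approximation. *)
Lemma exact_approx_seq X C' C E K K' (d' : hom C' C) (d : hom C E)
    (k : hom K C) (k' : hom K' C') :
  d ∘ d' = 0 -> X C' ->
  (forall P (f : hom P C), X P -> d ∘ f = 0 -> exists g, d' ∘ g = f) ->
  is_kernel k d -> is_kernel k' d' ->
  exists q : hom C' K, approx_seq X k' q.
Proof.
move=> dd' XC' ex kd kd'.
have [q kq] := kernel_lift kd dd'; have kmono := kernel_mono kd.
exists q; split.
  split=> // P' g XP'; have [|h hP] := ex P' (k ∘ g) XP'.
    by rewrite mcompA (proj1 kd) mcomp0m.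
  by exists h; apply: kmono; rewrite mcompA kq.
split=> [|T t qt]; first by apply: kmono; rewrite mcompA kq (proj1 kd') mcompm0.
by apply: (proj2 kd'); rewrite -kq -mcompA qt mcompm0.
Qed.

Lemma iso_kernel_zero M C E (d : hom C E) :
  iso C M -> is_zero E -> exists k : hom M C, is_kernel k d.
Proof.
move=> [f [g [gf fg]]] [_ E0]; exists g; split=> [|T t _]; first exact: E0.
exists (f ∘ t); split=> [|u <-]; first by rewrite mcompA gf mcomp1m.
by rewrite mcompA fg mcomp1m.
Qed.

End Sequences.

Section Dual.
Variable A : abelian_cat.
Implicit Types (X Y : A -> Prop) (M N K P Q L : A).

(** N has a Y-coresolution of length at most m. *)
Definition cores_length Y (m : nat) N : Prop :=
  @res_length (opp_abelian A) Y m N.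

Lemma cores_lengthS Y m N :
  cores_length Y m.+1 N <->
  exists (Q L : A) (c : hom Q L) (j : hom N Q),
    coapprox_seq Y j c /\ cores_length Y m L.
Proof. by []. Qed.

Lemma coapprox_seq_right_exact X Y N Q L (j : hom N Q) (c : hom Q L) :
  (forall M : A, @balanced_presentation (opp_abelian A) Y X M) ->
  coapprox_seq Y j c -> right_exact_seq X j c.
Proof. exact: (@approx_seq_left_exact (opp_abelian A)). Qed.

Lemma cores_length_seq Y m N :
  (forall M, is_zero M -> Y M) -> cores_length Y m.+1 N ->
  exists (Q L : A) (c : hom Q L) (j : hom N Q),
    [/\ coapprox_seq Y j c, cores_length Y m L &
        is_zero N -> is_zero Q /\ is_zero L].
Proof.
move=> Y0 NY.
have Y0' M : @is_zero (opp_preadditive A) M -> Y M by case=> ? ?; apply: Y0.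
have [Q [L [c [j [jc LY z]]]]] := @res_length_seq (opp_abelian A) Y m N Y0' NY.
exists Q, L, c, j; split=> // N0.
by have [[? ?] [? ?]] := z (is_zero_opp N0).
Qed.

Lemma cores_length_biprod Y m Q L :
  (forall M N, Y M -> Y N -> Y (bsum (biprod M N))) ->
  Y Q -> cores_length Y m L -> cores_length Y m (bsum (biprod Q L)).
Proof. exact: (@res_length_biprod (opp_abelian A)). Qed.

Lemma exact_coapprox_seq Y E C C' L L' (d : hom E C) (d' : hom C C')
    (c : hom C L) (c' : hom C' L') :
  d' ∘ d = 0 -> Y C' ->
  (forall Q (f : hom C Q), Y Q -> f ∘ d = 0 -> exists g, g ∘ d' = f) ->
  is_cokernel c d -> is_cokernel c' d' ->
  exists j : hom L C', coapprox_seq Y j c'.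
Proof. exact: (@exact_approx_seq (opp_abelian A)). Qed.

Lemma iso_cokernel_zero N C E (d : hom E C) :
  iso C N -> is_zero E -> exists c : hom C N, is_cokernel c d.
Proof.
move=> [f [g [gf fg]]] [E1 E2].
by apply: (@iso_kernel_zero (opp_abelian A)); [exists g, f|split].
Qed.

End Dual.

(** * Resolutions *)

Section Resolutions.
Variable A : abelian_cat.
Implicit Types (X Y : A -> Prop) (M N : A) (C : complex A).

(** The terms of C in degrees -2, -1, 0 and 1; the degrees are written as
    successors of a variable i to avoid transports along equations in int. *)
Lemma resolution_balanced_presentation X Y M C :
  resolution X M C -> left_acyclic Y C -> balanced_presentation X Y M.
Proof.
have [i i1] : exists i : int, i + 1 + 1 + 1 = 1 by exists (- 2).
move=> [M1 XC C0 XaC] YaC; move: M1; rewrite -i1 => -[f [g [gf fg]]].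
have ginj T (t t' : hom M T) : t ∘ f = t' ∘ f -> t = t'.
  by move=> e; rewrite -[t]mcompm1 -fg mcompA e -mcompA fg mcompm1.
have finj T (t : hom T (C (i + 1 + 1 + 1))) : f ∘ t = 0 -> t = 0.
  by move=> e; rewrite -[t]mcomp1m -gf -mcompA e mcompm0.
exists (C (i + 1 + 1)), (C (i + 1)), (C i).
exists (f ∘ diff C _), (diff C _), (diff C i); split.
- by rewrite -mcompA diffK mcompm0.
- exact: diffK.
- split=> [|P' h XP']; first by apply: XC; lia.
  have [|e eP] := XaC _ XP' (i + 1 + 1) (g ∘ h).
    apply: (proj2 (C0 _ _)); lia.
  by exists e; rewrite -mcompA eP mcompA fg mcomp1m.
- move=> P h XP; rewrite -mcompA => /finj; exact: XaC.
- move=> Q YQ; split=> [h|h hd|h hd].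
  + rewrite mcompA => /(YaC _ YQ)[e eP].
    have: h ∘ f = 0.
      rewrite -eP; suff -> : e = 0 by exact: mcomp0m.
      apply: (proj1 (C0 _ _)); lia.
    by rewrite -(mcomp0m (X := C (i + 1 + 1 + 1)) Q f) => /ginj.
  + have [e eP] := YaC _ YQ _ _ hd.
    by exists (e ∘ g); rewrite !mcompA -(mcompA e) gf mcompm1.
  + exact: YaC.
Qed.

Lemma coresolution_balanced_presentation X Y N C :
  coresolution Y N C -> right_acyclic X C ->
  @balanced_presentation (opp_abelian A) Y X N.
Proof.
have [i i1] : exists i : int, i + 1 = - 1 by exists (- 2).
move=> [N1 YC C0 YaC] XaC; move: N1; rewrite -i1 => -[g [f [fg gf]]].
have ginj T (t : hom T N) : f ∘ t = 0 -> t = 0.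
  by move=> e; rewrite -[t]mcomp1m -gf -mcompA e mcompm0.
have finj T (t : hom (C (i + 1)) T) : t ∘ f = 0 -> t = 0.
  by move=> e; rewrite -[t]mcompm1 -fg mcompA e mcomp0m.
exists (C (i + 1 + 1)), (C (i + 1 + 1 + 1)), (C (i + 1 + 1 + 1 + 1)).
exists (diff C _ ∘ f), (diff C _), (diff C _); split=> /=.
- by rewrite mcompA diffK mcomp0m.
- exact: diffK.
- split=> [|Q' h YQ' /=]; first by apply: YC; lia.
  have [|e eP] := YaC _ YQ' i ((h : @hom A N Q') ∘ g).
    apply: (proj1 (C0 _ _)); lia.
  by exists e; rewrite mcompA eP -mcompA gf mcompm1.
- move=> Q h YQ /=; rewrite mcompA => /finj; exact: YaC.
- move=> P XP; split=> [h|h hd|h hd] /=.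
  + rewrite -mcompA => /(XaC _ XP)[e eP]; apply: ginj.
    rewrite -eP; suff -> : e = 0 by exact: mcompm0.
    apply: (proj2 (C0 _ _)); lia.
  + have [e eP] := XaC _ XP _ _ hd.
    by exists (g ∘ e) => /=; rewrite -!mcompA (mcompA f) fg mcomp1m.
  + exact: XaC.
Qed.

(** The kernel in degree i is in X when the resolution vanishes there, and one
    approximation sequence leads from each kernel to the next. *)
Lemma resolution_kernel_length X M C (n m : nat) (i : int) K
    (k : hom K (C i)) :
  (forall N, is_zero N -> X N) -> resolution X M C ->
  (forall j : int, j < - n%:Z -> is_zero (C j)) ->
  i <= 1 -> i < m%:Z - n%:Z -> is_kernel k (diff C i) -> res_length X m K.
Proof.
move=> X0 [_ XC _ XaC] Cn; elim: m i K k => [|m IHm] i K k i1 im kP.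
  by apply: X0; apply: (kernel_zero kP); apply: Cn; lia.
have [j ji] : exists j, i = j + 1 by exists (i - 1); rewrite subrK.
subst i; have [K' [k' k'P]] := kernel_ex (diff C j).
have XCj : X (C j) by apply: XC; lia.
have [q qP] := exact_approx_seq (diffK C j) XCj
  (fun P f XP => XaC P XP j f) kP k'P.
exists (C j), K', k', q; split=> //; apply: IHm k'P; lia.
Qed.

(** The object M is itself the kernel of the differential in degree 1; the bound
    n + 2 is not sharp, and any finite bound suffices. *)
Lemma res_dim_length X M (n : nat) :
  (forall N, is_zero N -> X N) -> le_enat (res_dim X M) (Some n) ->
  res_length X n.+2 M.
Proof.
move=> X0; rewrite /res_dim /least; case: pselect => // exP.
case: ex_minnP => n' /asboolP[C [CM Cn']] _ /= n'n.
have [M1 _ C2 _] := CM.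
have [|k kP] := iso_kernel_zero (diff C 1) M1; first exact: C2.
have Cn (j : int) : j < - n%:Z -> is_zero (C j).
  by move=> jn; apply: Cn'; lia.
apply: (resolution_kernel_length (m := n.+2) X0 CM Cn _ _ kP); lia.
Qed.

Lemma coresolution_cokernel_length Y N C (n m : nat) (i : int) L
    (c : hom (C (i + 1)) L) :
  (forall M, is_zero M -> Y M) -> coresolution Y N C ->
  (forall j : int, n%:Z < j -> is_zero (C j)) ->
  - 2 <= i -> n%:Z - m%:Z <= i -> is_cokernel c (diff C i) ->
  cores_length Y m L.
Proof.
move=> Y0 [_ YC _ YaC] Cn; elim: m i L c => [|m IHm] i L c i1 im cP.
  by apply: Y0; apply: (cokernel_zero cP); apply: Cn; lia.
have [L' [c' c'P]] := cokernel_ex (diff C (i + 1)).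
have YCi : Y (C (i + 1 + 1)) by apply: YC; lia.
have [j jP] := exact_coapprox_seq (diffK C i) YCi
  (fun Q f YQ => YaC Q YQ i f) cP c'P.
apply/cores_lengthS; exists (C (i + 1 + 1)), L', c', j; split=> //.
apply: IHm c'P; lia.
Qed.

Lemma cores_dim_length Y N (n : nat) :
  (forall M, is_zero M -> Y M) -> le_enat (cores_dim Y N) (Some n) ->
  cores_length Y n.+2 N.
Proof.
move=> Y0; rewrite /cores_dim /least; case: pselect => // exP.
case: ex_minnP => n' /asboolP[C [CN Cn']] _ /= n'n.
have [N1 _ C2 _] := CN.
have [i i1] : exists i : int, i + 1 = - 1 by exists (- 2).
rewrite -i1 in N1.
have [|c cP] := iso_cokernel_zero (diff C i) N1; first by apply: C2; lia.
have Cn (j : int) : n%:Z < j -> is_zero (C j).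
  by move=> jn; apply: Cn'; lia.
apply: (coresolution_cokernel_length (m := n.+2) Y0 CN Cn _ _ cP); lia.
Qed.

End Resolutions.

(** * Cones and matrix complexes *)

Section MatrixComplex.
Variables (A : abelian_cat) (U V : int -> A).
Variables (a : forall n, hom (U n) (U (n + 1))).
Variables (b : forall n, hom (V n) (U (n + 1))).
Variables (c : forall n, hom (U n) (V (n + 1))).
Variables (e : forall n, hom (V n) (V (n + 1))).
Hypothesis aabc : forall n, a (n + 1) ∘ a n + b (n + 1) ∘ c n = 0.
Hypothesis abbe : forall n, a (n + 1) ∘ b n + b (n + 1) ∘ e n = 0.
Hypothesis caec : forall n, c (n + 1) ∘ a n + e (n + 1) ∘ c n = 0.
Hypothesis cbee : forall n, c (n + 1) ∘ b n + e (n + 1) ∘ e n = 0.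

Definition mat_diff n :
  hom (bsum (biprod (U n) (V n))) (bsum (biprod (U (n + 1)) (V (n + 1)))) :=
  mat_hom _ _ (a n) (b n) (c n) (e n).

Lemma mat_diffK n : mat_diff (n + 1) ∘ mat_diff n = 0.
Proof.
rewrite {2}/mat_diff mat_pair !comp_copair !copairD.
by rewrite aabc abbe caec cbee !copair00 pair00.
Qed.

(** The complex with terms U n + V n and differential (a, b; c, e). *)
Definition mat_complex : complex A := Complex mat_diffK.

End MatrixComplex.

Section ConeAcyclic.
Variables (A : abelian_cat) (C D : complex A) (f : chain_map C D).

Lemma cone_diffE n :
  diff (cone f) n = mat_hom (biprod (C (n + 1)) (D n))
    (biprod (C (n + 1 + 1)) (D (n + 1))) (- diff C (n + 1)) 0
    (f (n + 1)) (diff D n).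
Proof.
rewrite /mat_hom /pair_hom /copair_hom mcomp0m addr0 mcompDr !mcompA addrA.
by [].
Qed.

(** Right acyclicity of the cone in terms of the components (u, v) of a
    cycle; [cone_left_acyclic] is the analogue for left acyclicity. *)
Lemma cone_right_acyclic (X : A -> Prop) :
  (forall P n (u : hom P (C (n + 1 + 1))) (v : hom P (D (n + 1))), X P ->
    diff C (n + 1 + 1) ∘ u = 0 -> f (n + 1 + 1) ∘ u + diff D (n + 1) ∘ v = 0 ->
    exists (w : hom P (C (n + 1))) (z : hom P (D n)),
      - (diff C (n + 1) ∘ w) = u /\ f (n + 1) ∘ w + diff D n ∘ z = v) ->
  right_acyclic X (cone f).
Proof.
move=> H P XP n g; rewrite !cone_diffE.
rewrite [g]pair_pr mat_pair -(pair00 (biprod _ _) P) => /pair_inj[].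
rewrite mcomp0m addr0 mcompNm => /eqP; rewrite oppr_eq0 => /eqP du dv.
have [w [z [<- <-]]] := H P n _ _ XP du dv.
exists (pair_hom (biprod (C (n + 1)) (D n)) w z).
by rewrite mat_pair mcomp0m addr0 mcompNm.
Qed.

Lemma cone_left_acyclic (Y : A -> Prop) :
  (forall Q n (u : hom (C (n + 1 + 1)) Q) (v : hom (D (n + 1)) Q), Y Q ->
    v ∘ f (n + 1) = u ∘ diff C (n + 1) -> v ∘ diff D n = 0 ->
    exists (w : hom (C (n + 1 + 1 + 1)) Q) (z : hom (D (n + 1 + 1)) Q),
      - (w ∘ diff C (n + 1 + 1)) + z ∘ f (n + 1 + 1) = u /\
      z ∘ diff D (n + 1) = v) ->
  left_acyclic Y (cone f).
Proof.
move=> H Q YQ n g; rewrite !cone_diffE.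
rewrite [g]copair_in copair_mat -(copair00 (biprod _ _) Q) => /copair_inj[].
rewrite mcompm0 add0r mcompmN => /(canRL (addKr _)).
rewrite opprK addr0 => du dv.
have [w [z [<- <-]]] := H Q n _ _ YQ du dv.
exists (copair_hom (biprod (C (n + 1 + 1 + 1)) (D (n + 1 + 1))) w z).
by rewrite copair_mat mcompm0 add0r mcompmN.
Qed.

End ConeAcyclic.

(** * Lowering the length of the terms of a complex *)

Section LowerResolution.
Variables (A : abelian_cat) (X Y : A -> Prop) (C : complex A).
Variables (P K : int -> A) (k : forall n, hom (K n) (P n)).
Variable p : forall n, hom (P n) (C n).
Hypothesis kp : forall n, approx_seq X (@k n) (@p n).

Let kmono n : is_mono (@k n) := kernel_mono (proj2 (kp n)).
Let pk n : @p n ∘ @k n = 0 := proj1 (proj2 (kp n)).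

(** The differential of C lifts to the objects P n up to an error h h = k th,
    and restricts to ka on the kernels; the terms P n + K (n + 1) absorb the
    error. *)
Lemma lower_resolution :
  (forall n, left_exact_seq Y (@k n) (@p n)) ->
  exists (D : complex A) (f : chain_map D C),
    (forall n, D n = bsum (biprod (P n) (K (n + 1)))) /\ star_acyclic X Y (cone f).
Proof.
move=> kpY.
have /all_sig[h ph] n : {h | @p (n + 1) ∘ h = diff C n ∘ @p n}.
  have [[XP _] _] := kp n; have [[_ pX] _] := kp (n + 1).
  exact/cid/pX.
have /all_sig[th kth] n : {t | @k (n + 1 + 1) ∘ t = h (n + 1) ∘ h n}.
  apply/cid/(kernel_lift (proj2 (kp _))).
  by rewrite mcompA ph -mcompA ph mcompA diffK mcomp0m.
have /all_sig[ka kka] n : {t | @k (n + 1) ∘ t = h n ∘ @k n}.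
  apply/cid/(kernel_lift (proj2 (kp _))).
  by rewrite mcompA ph -mcompA pk mcompm0.
have aabc n : h (n + 1) ∘ h n + @k (n + 1 + 1) ∘ (- th n) = 0.
  by rewrite mcompmN kth subrr.
have abbe n : h (n + 1) ∘ @k (n + 1) + @k (n + 1 + 1) ∘ (- ka (n + 1)) = 0.
  by rewrite mcompmN kka subrr.
have caec n : - th (n + 1) ∘ h n + - ka (n + 1 + 1) ∘ - th n = 0.
  apply: kmono; rewrite mcompm0 mcompNm mcompNm mcompmN opprK.
  rewrite mcompDr mcompmN !mcompA kth kka -(mcompA _ (@k _)) kth.
  by rewrite mcompA addNr.
have cbee n : - th (n + 1) ∘ @k (n + 1) + - ka (n + 1 + 1) ∘ - ka (n + 1) = 0.
  apply: kmono; rewrite mcompm0 mcompNm mcompNm mcompmN opprK.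
  rewrite mcompDr mcompmN !mcompA kth kka -(mcompA _ (@k _)) kka.
  by rewrite mcompA addNr.
pose E : complex A := mat_complex aabc abbe caec cbee.
pose pi n : hom (E n) (C n) := copair_hom (biprod (P n) (K (n + 1))) (@p n) 0.
have piP n : diff C n ∘ pi n = pi (n + 1) ∘ diff E n.
  rewrite /pi copair_mat comp_copair mcompm0 !mcomp0m !addr0.
  by rewrite ph pk.
exists E, (ChainMap piP); split=> //; split.
- apply: cone_right_acyclic => T n u v XT /=.
  rewrite [u]pair_pr /mat_diff mat_pair copair_pair mcomp0m addr0.
  move: (pr1 _ ∘ u) (pr2 _ ∘ u) => x y.
  rewrite -(pair00 (biprod _ _) T) => /pair_inj[hxky _] pxdv.
  (* Subtracting the boundary of (w, 0) from the cycle replaces v by 0 and x by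
     x + h w, which is then k z; what is left is the boundary of (0, - z). *)
  have [w pw] : exists w, @p (n + 1) ∘ w = v by exact: (proj2 (proj1 (kp _))).
  have [z kz] : exists z, @k (n + 1 + 1) ∘ z = x + h (n + 1) ∘ w.
    apply: kernel_lift (proj2 (kp _)) _.
    by rewrite mcompDr mcompA ph -mcompA pw.
  exists (pair_hom (biprod _ _) w (- z)), 0.
  rewrite mat_pair copair_pair mcompm0 mcomp0m !addr0 pw; split=> //.
  have -> : h (n + 1) ∘ w + @k (n + 1 + 1) ∘ - z = - x.
    by rewrite mcompmN kz opprD addrCA subrr addr0.
  have -> : - th (n + 1) ∘ w + - ka (n + 1 + 1) ∘ - z = - y.
    apply: kmono; rewrite !mcompNm mcompmN opprK mcompDr !mcompmN.
    rewrite !mcompA kth kka -(mcompA _ (@k _)) kz mcompDr mcompA.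
    rewrite [h _ ∘ x + _]addrC addKr.
    by apply/eqP; rewrite -addr_eq0 hxky.
  by rewrite /pair_hom !mcompmN -opprD opprK.
- apply: cone_left_acyclic => Q n u v YQ /=.
  rewrite [u]copair_in /mat_diff !copair_mat comp_copair.
  move: (u ∘ in1 _) (u ∘ in2 _) => x y.
  rewrite !mcompm0 !mcompmN => /copair_inj[vp xk] vd.
  (* The cochain is (w, 0; z): w extends - y along k, and x + w h then
     vanishes on k, so that it factors as z p. *)
  have [_ _ /(_ (- y))[w wk]] := kpY (n + 1 + 1 + 1) Q YQ.
  have [_ zex _] := kpY (n + 1 + 1) Q YQ.
  have [|z zp] := zex (x + w ∘ h (n + 1 + 1)).
    by rewrite mcompDl -mcompA -kka mcompA wk mcompNm.
  exists (copair_hom (biprod _ _) w 0), z.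
  rewrite copair_mat comp_copair mcompm0 !mcomp0m !addr0 zp wk; split.
    rewrite /copair_hom mcompNm mcomp0m addr0 opprD opprK mcompDl.
    by rewrite [LHS]addrC addrA addrK.
  have [vinj _ _] := kpY (n + 1) Q YQ.
  apply/eqP; rewrite -subr_eq0; apply/eqP/vinj.
  rewrite mcompBl -mcompA -ph mcompA zp vp mcompDl -mcompA -kth.
  by rewrite (mcompA w) wk mcompNm subrr.
Qed.

End LowerResolution.

(** A family indexed by the degrees n + 1 is a family indexed by all degrees. *)
Lemma shifted_choice (T : int -> Type) (R : forall n, T (n + 1) -> Prop) :
  (forall n, exists t, R n t) ->
  exists F : forall n, T n, forall n, R n (F (n + 1)).
Proof.
move=> exR.
have /all_sig[F FP] m :
    {t : T m | forall n (e : m = n + 1), R n (ecast m (T m) e t)}.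
  rewrite -(subrK 1 m); have [t tP] := cid (exR (m - 1)).
  exists t => n e; have mn := addIr 1 e; move: e; rewrite -mn => e.
  by rewrite eq_axiomK.
by exists F => n; apply: (FP _ n erefl).
Qed.

Section LowerCoresolution.
Variables (A : abelian_cat) (X Y : A -> Prop) (C : complex A).
Variables (Q L : int -> A) (j : forall n, hom (C n) (Q n)).
Variable c : forall n, hom (Q n) (L (n + 1)).
Hypothesis jc : forall n, coapprox_seq Y (@j n) (@c n).

Let cepi n : is_epi (@c n) := cokernel_epi (proj2 (jc n)).
Let cj n : @c n ∘ @j n = 0 := proj1 (proj2 (jc n)).

(** The dual of [lower_resolution]; the cokernel of C n -> Q n is L (n + 1), so
    that the term in degree n is Q n + L n. *)
Lemma lower_coresolution :
  (forall n, right_exact_seq X (@j n) (@c n)) ->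
  exists (D : complex A) (f : chain_map C D),
    (forall n, D n = bsum (biprod (Q n) (L n))) /\ star_acyclic X Y (cone f).
Proof.
move=> jcX.
have /all_sig[h hj] n : {h | h ∘ @j n = @j (n + 1) ∘ diff C n}.
  have [[_ jY] _] := jc n; have [[YQ _] _] := jc (n + 1).
  exact/cid/jY.
have [th thc] : exists th : forall n, hom (L n) (Q (n + 1)),
    forall n, th (n + 1) ∘ @c n = h (n + 1) ∘ h n.
  apply: (shifted_choice (R := fun n t => t ∘ @c n = h (n + 1) ∘ h n)) => n.
  apply: (cokernel_desc (proj2 (jc _))).
  by rewrite -mcompA hj mcompA hj -mcompA diffK mcompm0.
have [la lac] : exists la : forall n, hom (L n) (L (n + 1)),
    forall n, la (n + 1) ∘ @c n = @c (n + 1) ∘ h n.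
  apply: (shifted_choice (R := fun n t => t ∘ @c n = @c (n + 1) ∘ h n)) => n.
  apply: (cokernel_desc (proj2 (jc _))).
  by rewrite -mcompA hj mcompA cj mcomp0m.
have aabc n : h (n + 1) ∘ h n + - th (n + 1) ∘ @c n = 0.
  by rewrite mcompNm thc subrr.
have abbe n : h (n + 1) ∘ - th n + - th (n + 1) ∘ - la n = 0.
  rewrite -(subrK 1 n); apply: cepi; rewrite mcomp0m mcompmN mcompNm mcompmN.
  rewrite opprK mcompDl mcompNm -!mcompA thc lac mcompA.
  by rewrite (mcompA (th _)) thc addNr.
have caec n : @c (n + 1) ∘ h n + - la (n + 1) ∘ @c n = 0.
  by rewrite mcompNm lac subrr.
have cbee n : @c (n + 1) ∘ - th n + - la (n + 1) ∘ - la n = 0.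
  rewrite -(subrK 1 n); apply: cepi; rewrite mcomp0m mcompmN mcompNm mcompmN.
  rewrite opprK mcompDl mcompNm -!mcompA thc lac mcompA.
  by rewrite (mcompA (la _)) lac addNr.
pose E : complex A := mat_complex aabc abbe caec cbee.
pose iota n : hom (C n) (E n) := pair_hom (biprod (Q n) (L n)) (@j n) 0.
have iotaP n : diff E n ∘ iota n = iota (n + 1) ∘ diff C n.
  rewrite /iota /= /mat_diff mat_pair comp_pair !mcompm0 mcomp0m !addr0.
  by rewrite hj cj.
exists E, (ChainMap iotaP); split=> //; split.
- apply: cone_right_acyclic => T n u v XT /=.
  rewrite [v]pair_pr /iota /mat_diff mat_pair comp_pair mcomp0m pairD add0r.
  move: (pr1 _ ∘ v) (pr2 _ ∘ v) => x y.
  rewrite !mcompNm -(pair00 (biprod _ _) T) => du /pair_inj[jxy cxy].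
  (* With c b = y, the map x - h b is killed by c and factors as j a. *)
  have [b cb] : exists b, @c n ∘ b = y by have [_ _] := jcX n T XT; apply.
  have [_ aex _] := jcX (n + 1) T XT.
  have [|a ja] := aex (x - h n ∘ b).
    by rewrite mcompBr mcompA -lac -mcompA cb.
  exists a, (pair_hom (biprod _ _) b 0).
  rewrite mat_pair comp_pair mcomp0m !mcompm0 !addr0 ja cb pairD add0r subrK.
  split=> //; have [uinj _ _] := jcX (n + 1 + 1) T XT.
  apply/eqP; rewrite eq_sym -addr_eq0; apply/eqP/uinj.
  by rewrite mcompDr mcompA -hj -mcompA ja mcompBr mcompA -thc -mcompA cb.
- apply: cone_left_acyclic => T n u v YT /=.
  rewrite [v]copair_in /mat_diff !copair_mat copair_pair mcompm0 addr0.
  move: (v ∘ in1 _) (v ∘ in2 _) => x y.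
  rewrite -(copair00 (biprod _ _) T) => xj /copair_inj[xhyc xty].
  (* With w j = u, the map x - w h vanishes on j and factors as z c. *)
  have [w wj] : exists w, w ∘ @j (n + 1 + 1) = u.
    exact: (proj2 (proj1 (jc _))).
  have [z zc] : exists z, z ∘ @c (n + 1) = x - w ∘ h (n + 1).
    apply: (cokernel_desc (proj2 (jc _))).
    by rewrite mcompBl -mcompA hj mcompA wj xj subrr.
  exists 0, (copair_hom (biprod _ _) w z).
  rewrite copair_mat copair_pair mcomp0m mcompm0 oppr0 add0r addr0 wj zc.
  split=> //; rewrite [w ∘ _ + _]addrC subrK; congr copair_hom.
  apply: cepi; rewrite !mcompmN mcompDl !mcompNm -!mcompA thc lac (mcompA z) zc.
  rewrite mcompBl -(mcompA w) opprB addKr.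
  by apply/eqP; rewrite eq_sym -addr_eq0 [y ∘ _ + _]addrC xhyc.
Qed.

End LowerCoresolution.

(** * Complexes over the two subcategories *)

Section Isomorphic.
Variable K : category.

Lemma isomorphic_refl (M : K) : isomorphic M M.
Proof. by exists (cat_id M), (cat_id M); split; apply: cat_comp1m. Qed.

Lemma isomorphic_sym (M N : K) : isomorphic M N -> isomorphic N M.
Proof. by move=> [f [g [gf fg]]]; exists g, f. Qed.

Lemma isomorphic_trans (M N P : K) :
  isomorphic M N -> isomorphic N P -> isomorphic M P.
Proof.
have inv (M' N' P' : K) (f : cat_hom M' N') (g : cat_hom N' M')
    (f' : cat_hom N' P') (g' : cat_hom P' N') :
    cat_eq (cat_comp g f) (cat_id M') -> cat_eq (cat_comp g' f') (cat_id N') ->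
    cat_eq (cat_comp (cat_comp g g') (cat_comp f' f)) (cat_id M').
  move=> gf g'f'.
  have [rM sM tM] := cat_eq_equiv M' M'; have [rMN sMN tMN] := cat_eq_equiv M' N'.
  apply: (tM _ _ _ _ gf); apply: (tM _ _ _ (sM _ _ (cat_compA _ _ _))).
  apply: cat_eq_comp; first by have [r _ _] := cat_eq_equiv N' M'; apply: r.
  apply: (tMN _ _ _ (cat_compA _ _ _)).
  apply: (tMN _ _ _ _ (cat_comp1m _)); apply: cat_eq_comp => //; exact: rMN.
move=> [f [g [gf fg]]] [f' [g' [gf' fg']]].
by exists (cat_comp f' f), (cat_comp g g'); split; apply: inv.
Qed.

End Isomorphic.

Lemma star_acyclic_cone_iso (A : abelian_cat) (X Y : A -> Prop)
    (C D : bcomplex A) (f : chain_map C D) :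
  star_acyclic X Y (cone f) -> @isomorphic (Db X Y) C D.
Proof.
move=> fW.
exists (@loc_of (Kb A) (fun C D f => star_acyclic X Y (cone f)) C D f).
exists (@loc_inv (Kb A) (fun C D f => star_acyclic X Y (cone f)) C D f fW).
by split; [exact: loc_invK | exact: loc_Kinv].
Qed.

Section Induction.
Variables (A : abelian_cat) (X Y : A -> Prop).
Hypothesis bal : balanced_pair X Y.

Let X0 M : is_zero M -> X M.
Proof. by have [[[_ + _ _] _] _ _ _ _] := bal; apply. Qed.

Let Y0 M : is_zero M -> Y M.
Proof. by have [[_ [_ + _ _]] _ _ _ _] := bal; apply. Qed.

Let XD M N : X M -> X N -> X (bsum (biprod M N)).
Proof. by have [[[_ _ + _] _] _ _ _ _] := bal; apply. Qed.

Let YD M N : Y M -> Y N -> Y (bsum (biprod M N)).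
Proof. by have [[_ [_ _ + _]] _ _ _ _] := bal; apply. Qed.

(** Induction on m, replacing C by the complex of [lower_resolution]; vanishing
    of the chosen sequences over zero objects keeps it bounded. *)
Lemma res_length_iso m (C : bcomplex A) :
  over (res_length X m) C ->
  exists D : bcomplex A, over X D /\ @isomorphic (Db X Y) C D.
Proof.
elim: m C => [|m IHm] C CX; first by exists C; split=> //; apply: isomorphic_refl.
have /all_sig[s sP] n : {s : {P : A & {K : A & (hom K P * hom P (C n))%type}} |
    [/\ approx_seq X (projT2 (projT2 s)).1 (projT2 (projT2 s)).2,
        res_length X m (projT1 (projT2 s)) &
        is_zero (C n) -> is_zero (projT1 s) /\ is_zero (projT1 (projT2 s))]}.
  apply: cid; have [P [K [k [p kp]]]] := res_length_seq X0 (CX n).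
  by exists (existT _ P (existT _ K (k, p))).
pose P n := projT1 (s n); pose K n := projT1 (projT2 (s n)).
have [n||D [f [DE fW]]] := @lower_resolution A X Y C P K
  (fun n => (projT2 (projT2 (s n))).1) (fun n => (projT2 (projT2 (s n))).2).
- by have [] := sP n.
- move=> n; have [kp _ _] := sP n; apply: approx_seq_left_exact kp => N.
  have [_ _ _ res _] := bal; have [S [SN SY]] := res N.
  exact: resolution_balanced_presentation SN SY.
have bndD : is_bounded D.
  have [a [b Cab]] := bcplxP C; exists (a - 1), b => n nab; rewrite DE.
  apply: biproduct_zero; first by have [_ _ []] := sP n; first by apply: Cab; lia.
  by have [_ _ []] := sP (n + 1); first by apply: Cab; lia.
have [|E [EX DE']] := IHm (BComplex bndD).
  move=> n /=; rewrite DE; have [[[XP _] _] _ _] := sP n.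
  by apply: res_length_biprod => //; have [] := sP (n + 1).
exists E; split=> //; apply: isomorphic_trans DE'; apply: isomorphic_sym.
exact: (@star_acyclic_cone_iso A X Y (BComplex bndD) C f).
Qed.

Lemma cores_length_iso m (C : bcomplex A) :
  over (cores_length Y m) C ->
  exists D : bcomplex A, over Y D /\ @isomorphic (Db X Y) C D.
Proof.
elim: m C => [|m IHm] C CY; first by exists C; split=> //; apply: isomorphic_refl.
have [L exL] : exists L : int -> A, forall n, exists (Q : A) (c : hom Q (L (n + 1)))
    (j : hom (C n) Q), [/\ coapprox_seq Y j c, cores_length Y m (L (n + 1)) &
        is_zero (C n) -> is_zero Q /\ is_zero (L (n + 1))].
  apply: (shifted_choice (T := fun=> A) (R := fun n L => exists (Q : A)
    (c : hom Q L) (j : hom (C n) Q), [/\ coapprox_seq Y j c,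
      cores_length Y m L & is_zero (C n) -> is_zero Q /\ is_zero L])) => n.
  have [Q [L QL]] := cores_length_seq Y0 (CY n); by exists L, Q.
have /all_sig[s sP] n : {s : {Q : A & (hom Q (L (n + 1)%R) * hom (C n) Q)%type} |
    [/\ coapprox_seq Y (projT2 s).2 (projT2 s).1, cores_length Y m (L (n + 1)) &
        is_zero (C n) -> is_zero (projT1 s) /\ is_zero (L (n + 1))]}.
  apply: cid; have [Q [c [j jc]]] := exL n.
  by exists (existT _ Q (c, j)).
pose Q n := projT1 (s n).
have [n||D [f [DE fW]]] := @lower_coresolution A X Y C Q L
  (fun n => (projT2 (s n)).2) (fun n => (projT2 (s n)).1).
- by have [] := sP n.
- move=> n; have [jc _ _] := sP n; apply: coapprox_seq_right_exact jc => N.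
  have [_ _ _ _ cores] := bal; have [S [SN SX]] := cores N.
  exact: coresolution_balanced_presentation SN SX.
have bndD : is_bounded D.
  have [a [b Cab]] := bcplxP C; exists a, (b + 1) => n nab; rewrite DE.
  apply: biproduct_zero; first by have [_ _ []] := sP n; first by apply: Cab; lia.
  rewrite -(subrK 1 n).
  by have [_ _ []] := sP (n - 1); first by apply: Cab; lia.
have [|E [EY DE']] := IHm (BComplex bndD).
  move=> n /=; rewrite DE; have [[[YQ _] _] _ _] := sP n.
  by apply: cores_length_biprod => //; rewrite -(subrK 1 n); have [] := sP (n - 1).
exists E; split=> //; apply: isomorphic_trans DE'.
exact: (@star_acyclic_cone_iso A X Y C (BComplex bndD) f).
Qed.

End Induction.

Theorem theorem4p10 (A : abelian_cat) (X Y : A -> Prop) (hXY : balanced_pair X Y) :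
  (res_dim_sup X Y <> infty -> Kb_included X Y Y X) /\
  (cores_dim_sup Y X <> infty -> Kb_included X Y X Y).
Proof.
have [[[_ X0 _ _] [_ Y0 _ _]] _ _ _ _] := hXY.
(* In both cases the supremum gives one bound n for all terms of C. *)
split; rewrite /res_dim_sup /cores_dim_sup /least; case: pselect => // exP _ C CU.
- have [n /asboolP nP] := exP.
  apply: (res_length_iso hXY (m := n.+2)) => i.
  exact/res_dim_length/nP.
- have [n /asboolP nP] := exP.
  apply: (cores_length_iso hXY (m := n.+2)) => i.
  exact/cores_dim_length/nP.
Qed.
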